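(* Let $V = (C[a,b], \Vert \cdot \Vert_\infty)$ be the space of real-valued continuous functions on $[a,b]$ with the sup norm. For each $n$ let $a \le x_0^{(n)} < x_1^{(n)} < \cdots < x_n^{(n)} \le b$ be interpolation points, and let $P_n : V \to \mathbb{P}_n \subset V$ be the corresponding polynomial interpolation operator. Suppose that the interpolation $(P_n)$ is consistent. Then $(P_n)$ is convergent if and only if it is stable.
   Context: $\mathbb{P}_n$ is the space of real polynomials of degree at most $n$, viewed as functions on $[a,b]$. For $f \in V$, $P_n f$ is the unique $p \in \mathbb{P}_n$ with $p(x_i^{(n)}) = f(x_i^{(n)})$ for $0 \le i \le n$. Each $P_n$ is a bounded linear operator on $V$, and $\Vert P_n \Vert = \sup_{\Vert f \Vert_\infty = 1} \Vert P_n f \Vert_\infty$. Definitions: - Interpolation is convergent if for every $f \in V$ the sequence $P_n f$ converges to $f$ in $V$. - It is consistent if there is a dense linear subspace $V_0$ of $V$ such that $P_n f$ converges to $f$ in $V$ for every $f \in V_0$. - It is stable if $\sup_n \Vert P_n \Vert < \infty$. *)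

(* Defs.v *)
From HB Require Import structures.
From mathcomp Require Import all_boot all_order all_algebra.
From mathcomp Require Import qpoly.
From mathcomp Require Import all_classical all_reals all_analysis.

Set Implicit Arguments.
Unset Strict Implicit.
Unset Printing Implicit Defensive.

Import Order.TTheory GRing.Theory Num.Theory.
Import numFieldNormedType.Exports.

Local Open Scope classical_set_scope.
Local Open Scope ring_scope.

(* Continuous functions on [a, b] are taken on the subtype of points of [a, b]
   (with the subtype topology) rather than on the whole line: this makes the
   sup norm over [a, b] separated. *)
Notation icc a b := (set_type `[a, b]).

Section ContinuousFunctions.
Context {R : realType} (a b : R).

Definition is_cont : {pred icc a b -> R} := fun f => `[< continuous f >].

Record contab : Type := Contab {
  contab_fun :> icc a b -> R ;
  contab_subproof : contab_fun \in is_cont }.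

HB.instance Definition _ := [isSub for contab_fun].
HB.instance Definition _ := [Choice of contab by <:].

Lemma is_contP (f : icc a b -> R) : reflect (continuous f) (f \in is_cont).
Proof. exact: asboolP. Qed.

Lemma contab_continuous (f : contab) : continuous f.
Proof. exact/is_contP/contab_subproof. Qed.

Lemma is_cont_submod_closed : submod_closed is_cont.
Proof.
have contZD (T : topologicalType) (k : R) (f g : T -> R) :
    continuous f -> continuous g -> continuous (fun t => k * f t + g t).
  by move=> cf cg t; apply: cvgD; [apply: cvgM; [exact: cvg_cst|exact: cf]|exact: cg].
rewrite /submod_closed; split=> [|k f g /is_contP cf /is_contP cg].
  by apply/is_contP; exact: (@cst_continuous _ _ 0).
by apply/is_contP; exact: contZD.
Qed.

HB.instance Definition _ := GRing.isSubmodClosed.Build R (icc a b -> R)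
  is_cont is_cont_submod_closed.

HB.instance Definition _ := [SubChoice_isSubLmodule of contab by <:].

Definition supnorm (f : contab) : R := sup (range (fun t => `|f t|)).

Lemma contab_has_ubound (f : contab) : has_ubound (range (fun t => `|f t|)).
Proof.
have cf : {within `[a, b], continuous (valL f)}.
  exact/subspace_valL_continuousP/contab_continuous.
have [M [_ /(_ (M + 1))]] :=
  compact_bounded (continuous_compact cf (@segment_compact R a b)).
rewrite ltrDl ltr01 => /(_ isT) fM.
exists (M + 1) => _ [t _ <-]; apply: fM.
by exists (val t); [exact/set_mem/(valP t)|exact: (congr1 (@^~ t) (valLK point f))].
Qed.

Lemma supnorm_ub (f : contab) t : `|f t| <= supnorm f.
Proof. by apply: ub_le_sup; [exact: contab_has_ubound|exists t]. Qed.


Lemma le_supnorm (f : contab) M : 0 <= M -> (forall t, `|f t| <= M) ->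
  supnorm f <= M.
Proof.
move=> M0 fM; rewrite /supnorm.
have [->|ne] := eqVneq (range (fun t => `|f t|)) set0; first by rewrite sup0.
by apply: ge_sup; [exact/set0P|move=> _ [t _ <-]].
Qed.

Lemma supnorm_ge0 (f : contab) : 0 <= supnorm f.
Proof.
rewrite /supnorm.
have [->|/set0P[_ [t _ _]]] := eqVneq (range (fun t => `|f t|)) set0.
  by rewrite sup0.
exact: le_trans (supnorm_ub f t).
Qed.

Lemma ler_supnormD f g : supnorm (f + g) <= supnorm f + supnorm g.
Proof.
apply: le_supnorm => [|t]; first by rewrite addr_ge0 ?supnorm_ge0.
by rewrite (le_trans (ler_normD _ _))// lerD// supnorm_ub.
Qed.

Lemma supnormZ (k : R) f : supnorm (k *: f) = `|k| * supnorm f.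
Proof.
have le_supnormZ l g : supnorm (l *: g) <= `|l| * supnorm g.
  apply: le_supnorm => [|t]; first by rewrite mulr_ge0 ?supnorm_ge0.
  by rewrite normrM ler_wpM2l// supnorm_ub.
apply/eqP; rewrite eq_le le_supnormZ/=.
have [->|k0] := eqVneq k 0; first by rewrite normr0 mul0r supnorm_ge0.
rewrite -ler_pdivlMl ?normr_gt0// -normfV.
by rewrite -[in leLHS](scalerK k0 f) le_supnormZ.
Qed.

Lemma supnorm_eq0 f : supnorm f = 0 -> f = 0.
Proof.
move=> f0; apply/val_inj/funext => t /=.
by apply/eqP; rewrite -normr_le0 -f0 supnorm_ub.
Qed.

HB.instance Definition _ := Lmodule_isNormed.Build R contab
  ler_supnormD supnormZ supnorm_eq0.

End ContinuousFunctions.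

Section Interpolation.
Context {R : realType} (a b : R).

Lemma horner_is_cont (p : {poly R}) :
  (fun t : icc a b => p.[\val t]) \in @is_cont R a b.
Proof.
have contC (T : topologicalType) (h : T -> R) :
    continuous h -> continuous (fun t => p.[h t]).
  by move=> ch t; apply: (continuous_comp (ch t)); exact: continuous_horner.
by apply/is_contP; apply: contC; exact: initial_continuous.
Qed.

Definition horner_contab (p : {poly R}) : contab a b := Contab (horner_is_cont p).

Definition interpolates n (x : 'I_n.+1 -> icc a b) (f : contab a b)
    (p : {poly R}) : Prop :=
  forall i, p.[\val (x i)] = f (x i).

(* [{poly_m R}] bounds the size, so [{poly_n.+1 R}] is the space of polynomials
   of degree at most n.  The default value 0 of [xget] is never reached for
   distinct nodes, by [interp_exists_unique]. *)
Definition interp_poly n (x : 'I_n.+1 -> icc a b) (f : contab a b) :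
    {poly_n.+1 R} :=
  xget 0 [set p : {poly_n.+1 R} | interpolates x f p].

Lemma interp_exists_unique n (x : 'I_n.+1 -> icc a b) (f : contab a b) :
  injective x -> exists! p : {poly_n.+1 R}, interpolates x f p.
Proof.
move=> xinj.
pose l (i : 'I_n.+1) : {poly R} := \prod_(j | j != i) ('X - (\val (x j))%:P).
have size_l i : size (l i) = n.+1.
  by rewrite /l -(big_enum *%R 1 (predC1 i)) size_prod_XsubC -cardE cardC1 card_ord.
have lii i : (l i).[\val (x i)] != 0.
  rewrite horner_prod; apply/prodf_neq0 => j ji.
  by rewrite hornerXsubC subr_eq0 (inj_eq val_inj) (inj_eq xinj) eq_sym.
have lij i j : i != j -> (l i).[\val (x j)] = 0.
  move=> ij; rewrite horner_prod (bigD1 j) 1?eq_sym//=.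
  by rewrite hornerXsubC subrr mul0r.
pose p : {poly R} := \sum_i (f (x i) / (l i).[\val (x i)]) *: l i.
have size_p : p \is a poly_of_size n.+1.
  rewrite qualifE/=; apply: (leq_trans (size_sum _ _ _)).
  by apply/bigmax_leqP => i _; rewrite (leq_trans (size_scale_leq _ _))// size_l.
have px i : p.[\val (x i)] = f (x i).
  rewrite horner_sum (bigD1 i)//= hornerZ divfK// big1 ?addr0// => j ji.
  by rewrite hornerZ (lij j i ji) mulr0.
exists (NPoly size_p); split=> [//|q qx].
apply/val_inj => /=; apply/eqP; rewrite -subr_eq0; apply/eqP.
apply: (@roots_geq_poly_eq0 _ _ [seq \val (x i) | i <- enum 'I_n.+1]).
- by apply/allP => _ /mapP[i _ ->]; rewrite rootE hornerD hornerN px qx subrr.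
- by rewrite map_inj_uniq ?enum_uniq// => i j /val_inj/xinj.
- rewrite size_map size_enum_ord.
  rewrite (leq_trans (size_polyD _ _))// size_polyN geq_max size_npoly.
  by rewrite (size_npoly (NPoly size_p)).
Qed.

Lemma interp_polyP n (x : 'I_n.+1 -> icc a b) (f : contab a b) :
  injective x -> interpolates x f (interp_poly x f).
Proof.
move=> /interp_exists_unique-/(_ f)[p [px _]].
pose S := [set q : {poly_n.+1 R} | interpolates x f q].
by apply: (@xgetPex _ 0 S); exists p.
Qed.

Definition interp n (x : 'I_n.+1 -> icc a b) (f : contab a b) : contab a b :=
  horner_contab (interp_poly x f).

End Interpolation.

Section ApproximationProcesses.
Context {R : realType} {V : normedModType R}.
Implicit Type P : nat -> V -> V.

Definition convergent P := forall f : V, P n f @[n --> \oo] --> f.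

Definition consistent P := exists V0 : set V,
  [/\ submod_closed (mem V0), dense V0 &
      forall f, V0 f -> P n f @[n --> \oo] --> f].

(* Extended-real-valued, so that an unbounded operator has norm +oo instead of
   the junk value of the real-valued [sup]. *)
Definition opnorm (T : V -> V) : \bar R :=
  ereal_sup [set (`|T f|)%:E | f in [set f | `|f| = 1]].

Definition stable P : Prop :=
  (ereal_sup (range (fun n => opnorm (P n))) < +oo)%E.

End ApproximationProcesses.

(* Main.v *)
Require Import Defs.
From HB Require Import structures.
From mathcomp Require Import all_boot all_order all_algebra.
From mathcomp Require Import qpoly.
From mathcomp Require Import all_classical all_reals all_analysis.
From mathcomp Require Import lra.

(** The equivalence is the Lax principle for a sequence of bounded linear
    operators on a Banach space that converges pointwise on a dense set.

    If the operators converge pointwise everywhere, they are pointwise bounded,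
    hence uniformly bounded by the Banach-Steinhaus theorem
    ([convergent_stable]).  This is where completeness of C[a, b] enters
    ([contab_complete]): a uniformly Cauchy filter has a pointwise limit, which
    is a uniform limit and so is continuous.

    Conversely, if all norms are at most M, approximate f by some g of the dense
    set; then f - P_n f = (f - g) + (g - P_n g) - P_n (f - g), whose outer terms
    together have norm at most (M + 1) |f - g|, whatever n is, while the middle
    one tends to 0 ([consistent_stable_convergent]).

    Interpolation operators are bounded and linear because the Lagrange formula
    writes P_n f as the sum of the f(x_i) L_i, with finitely many functions L_i
    that do not depend on f ([interp_lagrange]). *)

Import Order.TTheory GRing.Theory Num.Theory.
Import numFieldNormedType.Exports.

Local Open Scope classical_set_scope.
Local Open Scope ring_scope.

(** The uniform limit theorem, in a form that mentions no filter on functions.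
    Keeping the topological space abstract matters: on the subtype topology of
    [icc a b], filter instances are not inferred once [nbhs] is unfolded. *)
Lemma continuous_uniform_approx (R : realType) (T : topologicalType)
    (f : T -> R) :
  (forall e : R, 0 < e ->
    exists2 g : T -> R, continuous g & forall t, `|f t - g t| <= e) ->
  continuous f.
Proof.
move=> fP t; apply/cvgrPdist_le => e e0.
have e30 : 0 < e / 3 by rewrite divr_gt0.
have [g g_cont fg] := fP _ e30.
have /cvgrPdist_le/(_ _ e30) := g_cont t.
apply: filterS => s gts.
have -> : f t - f s = (f t - g t) + (g t - g s) + (g s - f s).
  by rewrite !addrA !subrK.
have -> : e = e / 3 + e / 3 + e / 3 by lra.
have gfs : `|g s - f s| <= e / 3 by rewrite distrC.
by rewrite (le_trans (ler_normD _ _)) ?lerD// (le_trans (ler_normD _ _)) ?lerD.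
Qed.

(** The limit is built pointwise; letting h run along the filter in
    |g(t) - h(t)| < e, for a fixed g, gives a bound |f(t) - g(t)| <= e that is
    uniform in t, so f is continuous and is the limit for the sup norm. *)
Lemma contab_complete (R : realType) (a b : R) (F : set_system (contab a b)) :
  ProperFilter F -> cauchy F -> cvg F.
Proof.
move=> FF /cauchy_ballP Fc.
have near_cauchy (e : R) : 0 < e -> exists2 AB, F AB.1 /\ F AB.2 &
    forall g h : contab a b, AB.1 g -> AB.2 h -> forall t, `|g t - h t| < e.
  move=> e0; have [[A B] /= FAB sub] := Fc e e0.
  exists (A, B) => // g h Ag Bh t.
  apply: le_lt_trans (supnorm_ub (g - h) t) _.
  by have := sub (g, h) (conj Ag Bh); rewrite /= -ball_normE.
have ev_cvg t : cvg ((fun f : contab a b => f t) @ F).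
  apply/cauchy_cvgP/cauchy_ballP => e e0.
  have [[A B] /= [FA FB] AB] := near_cauchy e e0.
  pose ev (f : contab a b) := f t.
  exists (ev @` A, ev @` B) => /=.
    by split; [exact: filterS (@preimage_image _ _ _ A) FA
              |exact: filterS (@preimage_image _ _ _ B) FB].
  by move=> [_ _] /= [[g Ag <-] [h Bh <-]]; exact: AB.
pose f t : R := lim ((fun f : contab a b => f t) @ F).
have near_lim (e : R) : 0 < e ->
    \forall g \near F, forall t, `|f t - (g : contab a b) t| <= e.
  move=> e0; have [[A B] /= [FA FB] AB] := near_cauchy e e0.
  apply: filterS FA => g Ag t; rewrite distrC.
  apply: (cvgr_to_le (F := F) (f := fun h : contab a b => `|g t - h t|)).
    by apply: cvg_norm; apply: cvgB; [exact: cvg_cst|exact: ev_cvg].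
  by apply: filterS FB => h Bh; apply/ltW/AB.
have f_cont : f \in @is_cont R a b.
  apply/is_contP; apply: continuous_uniform_approx => e e0.
  have [g fg] := filter_ex (near_lim e e0).
  by exists g => //; exact: contab_continuous.
apply/cvg_ex; exists (Contab f_cont); apply/cvgrPdist_le => e e0.
apply: filterS (near_lim e e0) => g fg.
by apply: le_supnorm => [|t]; [exact: ltW|exact: fg].
Qed.

HB.instance Definition _ (R : realType) (a b : R) :=
  Uniform_isComplete.Build (contab a b) (@contab_complete R a b).

(** Trades the extended-real supremum for a real bound.  This stays true in the
    zero space, where the supremum over the empty unit sphere is -oo. *)
Lemma stableP (R : realType) (V : normedModType R) (P : nat -> V -> V) :
  stable P <-> exists M : R, forall n f, `|f| = 1 -> `|P n f| <= M.
Proof.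
rewrite /stable; split=> [sP|[M PM]].
  set s := ereal_sup _ in sP.
  have Ps n f : `|f| = 1 -> (`|P n f|%:E <= s)%E.
    move=> f1; apply: (@le_trans _ _ (opnorm (P n))).
      by apply: ereal_sup_ubound; exists f.
    by apply: ereal_sup_ubound; exists n.
  exists (fine s) => n f f1; rewrite -lee_fin fineK; first exact: Ps.
  by rewrite fin_numE -ltey sP andbT -ltNye (lt_le_trans _ (Ps n f f1)) ?ltNyr.
apply: (@le_lt_trans _ _ M%:E); last exact: ltry.
apply: ge_ereal_sup => _ [n _ <-]; apply: ge_ereal_sup => _ [f f1 <-].
by rewrite lee_fin PM.
Qed.

Lemma linear_unit_bound (R : realType) (V W : normedModType R)
    (T : {linear V -> W}) (M : R) :
  (forall f, `|f| = 1 -> `|T f| <= M) -> forall f, `|T f| <= M * `|f|.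
Proof.
move=> TM f; have [->|f0] := eqVneq f 0; first by rewrite linear0 !normr0 mulr0.
rewrite -ler_pdivrMr ?normr_gt0//.
have := TM (`|f|^-1 *: f).
rewrite linearZ/= !normrZ normfV normr_id mulVf ?normr_eq0// => /(_ erefl).
by rewrite mulrC.
Qed.

(** The Banach-Steinhaus half: a convergent sequence P_n f is bounded. *)
Lemma convergent_stable (R : realType) (V : completeNormedModType R)
    (P : nat -> {linear V -> V}) :
  (forall n, bounded_fun_norm (P n)) -> convergent P -> stable P.
Proof.
move=> bP cP; apply/stableP.
have P_bounded_linear f : range (fun n => P n : V -> V) f ->
    bounded_fun_norm f /\ linear f.
  by move=> [n _ <-]; split; [exact: bP|exact: linearP].
have P_ptws : pointwise_bounded (range (fun n => P n : V -> V)).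
  move=> f; have /cvgP/cvg_seq_bounded[M [_ PM]] := cP f.
  by exists (M + 1) => _ [n _ <-]; apply: (PM (M + 1)) => //; rewrite ltrDl.
have [M PM] := Banach_Steinhauss P_bounded_linear P_ptws 1.
by exists M => n f f1; apply: PM; [exists n|rewrite f1].
Qed.

(** The density half: a uniform bound on the operators carries convergence from
    a dense set to its closure. *)
Lemma consistent_stable_convergent (R : realType) (V : normedModType R)
    (P : nat -> {linear V -> V}) :
  consistent P -> stable P -> convergent P.
Proof.
move=> [V0 [_ dV0 cV0]] /stableP[M0 PM0] f.
(* M0 may be negative when V has no unit vector. *)
pose M := Num.max M0 0.
have PM n g : `|P n g| <= M * `|g|.
  by apply: linear_unit_bound => {}g /PM0/le_trans; apply; rewrite le_max lexx.
have M_ge0 : 0 <= M by rewrite le_max lexx orbT.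
apply/cvgrPdist_lt => e e0.
(* This radius makes |f - g| + |P_n (f - g)| <= (M + 1) |f - g| < e / 2. *)
pose d := e / (2 * (M + 1)).
have d0 : 0 < d by rewrite divr_gt0// mulr_gt0// ltr_wpDl.
have [||g [fg V0g]] := dV0 (ball f d).
- by exists f; exact: ballxx.
- exact: ball_open.
rewrite -ball_normE /= ltr_pdivlMr in fg; last by rewrite mulr_gt0// ltr_wpDl.
have /cvgrPdist_lt/(_ _ (divr_gt0 e0 (ltr0Sn R 1))) := cV0 _ V0g.
apply: filterS => n gn.
have -> : f - P n f = (f - g) + (g - P n g) - P n (f - g).
  by rewrite linearB opprB !addrA !subrK.
apply: le_lt_trans (ler_normB _ _) _.
apply: le_lt_trans (lerD (ler_normD _ _) (PM n _)) _.
by move: gn fg; lra.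
Qed.

Lemma consistent_convergentP (R : realType) (V : completeNormedModType R)
    (P : nat -> {linear V -> V}) :
  (forall n, bounded_fun_norm (P n)) -> consistent P ->
  convergent P <-> stable P.
Proof.
move=> bP cP; split; first exact: convergent_stable.
exact: consistent_stable_convergent.
Qed.

(** The Lagrange interpolation formula.  It yields linearity and boundedness of
    [interp x] at once, as [f] enters only through finitely many values. *)
Lemma interp_lagrange (R : realType) (a b : R) n (x : 'I_n.+1 -> icc a b) :
  injective x ->
  exists L : 'I_n.+1 -> contab a b,
    forall f, interp x f = \sum_i f (x i) *: L i.
Proof.
move=> xinj.
(* [lagrange_gen] takes an injective sequence of sampling points indexed by all
   of [nat]: the nodes are continued by points beyond [b]. *)
pose y k : R := if insub k is Some i then \val (x i) else b + k.+1%:R.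
have y_x (i : 'I_n.+1) : y i = \val (x i) by rewrite /y valK.
have xb i : \val (x i) <= b.
  by have := set_mem (valP (x i)); rewrite /= in_itv/= => /andP[].
have y_inj : injective y.
  have bk i k : \val (x i) != b + k.+1%:R.
    by rewrite lt_eqF// (le_lt_trans (xb i))// ltrDl ltr0Sn.
  move=> j k; rewrite /y.
  case: insubP => [i _ <-|_]; case: insubP => [i' _ <-|_].
  - by move=> /val_inj/xinj ->.
  - by move/eqP; rewrite (negPf (bk _ _)).
  - by move/esym/eqP; rewrite (negPf (bk _ _)).
  - by move/addrI/eqP; rewrite eqr_nat => /eqP[].
exists (fun i => horner_contab a b (tnth (lagrange n.+1 y) i)) => f.
have hD : {morph horner_contab a b : p q / p + q}.
  by move=> p q; apply/val_inj/funext => t /=; rewrite hornerD.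
have h0 : horner_contab a b 0 = 0.
  by apply/val_inj/funext => t /=; rewrite horner0.
rewrite /interp (lagrange_gen _ y_inj (size_npoly (interp_poly x f)))//.
rewrite (big_morph _ hD h0); apply: eq_bigr => i _.
apply/val_inj/funext => t /=; rewrite hornerM hornerC y_x.
by rewrite (interp_polyP f xinj).
Qed.

Lemma interp_linear (R : realType) (a b : R) n (x : 'I_n.+1 -> icc a b) :
  injective x -> linear (interp x).
Proof.
move=> /interp_lagrange[L LE] k f g.
rewrite !LE scaler_sumr -big_split/=; apply: eq_bigr => i _.
by rewrite scalerDl scalerA.
Qed.

Lemma interp_bounded (R : realType) (a b : R) n (x : 'I_n.+1 -> icc a b) :
  injective x -> bounded_fun_norm (interp x).
Proof.
move=> /interp_lagrange[L LE] r; exists (\sum_i r * `|L i|) => f fr.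
rewrite LE; apply: le_trans (ler_norm_sum _ _ _) _; apply: ler_sum => i _.
by rewrite normrZ ler_wpM2r// (le_trans (supnorm_ub f (x i))).
Qed.

Theorem theorem6p5 (R : realType) (a b : R)
  (x : forall n : nat, 'I_n.+1 -> icc a b)
  (x_increasing : forall (n : nat) (i j : 'I_n.+1),
    (i < j)%N -> \val (x n i) < \val (x n j))
  (interp_consistent : consistent (fun n => interp (x n))) :
  convergent (fun n => interp (x n)) <-> stable (fun n => interp (x n)).
Proof.
have x_inj n : injective (x n).
  move=> i j xij; apply: val_inj.
  by have [/x_increasing|/x_increasing|//] := ltngtP i j; rewrite xij ltxx.
pose P n : {linear contab a b -> contab a b} :=
  HB.pack (interp (x n))
    (GRing.isLinear.Build _ _ _ _ _ (interp_linear _ _ _ _ _ (x_inj n))).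
apply: (@consistent_convergentP R (contab a b) P) => // n.
exact: interp_bounded.
Qed.
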